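(* Let $p$ be a prime and let $G$ be a normally monomial maximal class $p$-group. Let $|G|=p^{n}$, $b(G)=\max\{\chi(1)\mid \chi\in\mathrm{Irr}(G)\}$, and $b=\log_p(b(G))$. Then $\mathrm{cod}(G)=\{p^i\mid 0\le i\le c\}$ for some integer $c\ge n-b$.
   Context: All groups are finite. $\mathrm{Irr}(G)$ is the set of irreducible complex characters of $G$. The codegree of $\chi\in\mathrm{Irr}(G)$ is $\mathrm{cod}(\chi)=|G:\ker(\chi)|/\chi(1)$, and $\mathrm{cod}(G)=\{\mathrm{cod}(\chi)\mid\chi\in\mathrm{Irr}(G)\}$. A $p$-group of order $p^n$ has maximal class if $n\ge 3$ and its nilpotence class is $n-1$ (in particular, it is nonabelian). A character $\chi\in\mathrm{Irr}(G)$ is normally monomial if $\chi=\lambda^G$ is induced from a linear (degree $1$) character $\lambda$ of some normal subgroup of $G$; the group $G$ is normally monomial if every $\chi\in\mathrm{Irr}(G)$ is normally monomial. *)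

(* Defs.v *)
From HB Require Import structures.
From mathcomp Require Import all_boot all_order all_algebra all_fingroup.
From mathcomp Require Import all_solvable all_field all_character.

Set Implicit Arguments.
Unset Strict Implicit.
Unset Printing Implicit Defensive.

Import Order.TTheory GRing.Theory Num.Theory GroupScope.
Local Open Scope ring_scope.

Definition codegree (gT : finGroupType) (G : {group gT}) (chi : 'CF(G)) : algC :=
  #|G : cfker chi|%:R / chi 1%g.

Definition codegrees (gT : finGroupType) (G : {group gT}) : seq algC :=
  [seq codegree chi | chi <- irr G].

(* Degrees are natural numbers living in algC; truncn reads them back in nat. *)
Definition max_irr_degree (gT : finGroupType) (G : {group gT}) : nat :=
  (\max_(chi <- irr G) Num.truncn (chi 1%g))%N.

Definition maximal_class (p : nat) (gT : finGroupType) (G : {group gT}) : Prop :=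
  exists n : nat, [/\ (3 <= n)%N, #|G| = (p ^ n)%N & nil_class G = n.-1].

Definition normally_monomial_char (gT : finGroupType) (G : {group gT})
    (chi : 'CF(G)) : Prop :=
  exists (N : {group gT}) (lambda : 'CF(N)),
    [/\ N <| G, lambda \is a linear_char & chi = 'Ind[G] lambda].

Definition normally_monomial (gT : finGroupType) (G : {group gT}) : Prop :=
  forall chi : 'CF(G), chi \in irr G -> normally_monomial_char chi.

(* Main.v *)
(* If chi = 'Ind lambda is induced from a linear character of N <| G, then N is
   abelian modulo ker chi and chi(1) = |G : N|. So whenever ker chi <= ker psi,
   N is also abelian modulo ker psi, whence psi(1) <= chi(1) and
   cod(psi) >= cod(chi) / |ker psi : ker chi|. In a group of maximal class the
   normal subgroups of index at least p^3 are terms 'Z_i(G) of the upper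
   central series, and each of these is the kernel of an irreducible character.
   Moving up this chain of kernels divides the codegree by at most p at each
   step, so the exponents of the codegrees form an initial segment of nat; a
   faithful irreducible character chi has
   cod(chi) = p^n / chi(1) >= p^(n - b). *)

Require Import Defs.
From HB Require Import structures.
From mathcomp Require Import all_boot all_order all_algebra all_fingroup.
From mathcomp Require Import all_solvable all_field all_character.
From mathcomp Require Import zify.

Set Implicit Arguments.
Unset Strict Implicit.
Unset Printing Implicit Defensive.

Import Order.TTheory GRing.Theory Num.Theory GroupScope.
Local Open Scope ring_scope.

(** * Degrees, kernels and codegrees of irreducible characters *)

Section Codegrees.

Variables (gT : finGroupType) (G : {group gT}).

(** The restriction to [N] has linear constituents, being trivial on the derived subgroup. By
    Frobenius reciprocity ['chi_i] is a constituent of one of these induced to [G], which has degree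
    |G : N|. *)
Lemma irr1_le_index (N : {group gT}) i :
  N \subset G -> N^`(1)%g \subset cfker 'chi[G]_i -> 'chi_i 1%g <= #|G : N|%:R.
Proof.
move=> sNG sN'K; have [j Cj] := constt_cfRes_irr N i.
have linj : 'chi_j \is a linear_char.
  have sKj := cfker_constt (cfRes_char N (irr_char i)) Cj.
  rewrite lin_irr_der1 (subset_trans _ sKj) //.
  by rewrite cfker_Res ?irr_char // subsetI der_sub.
have <-: 'Ind[G] 'chi_j 1%g = #|G : N|%:R.
  by rewrite cfInd1 // lin_char1 // mulr1.
by rewrite char1_ge_constt ?cfInd_char ?irr_char // constt_Ind_Res.
Qed.

Lemma normally_monomial_charP (chi : 'CF(G)) :
  normally_monomial_char chi ->
  exists N : {group gT},
    [/\ N <| G, N^`(1)%g \subset cfker chi & chi 1%g = #|G : N|%:R].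
Proof.
case=> N [lam [nsNG linlam ->]]; have sNG := normal_sub nsNG.
exists N; split=> //.
  have lam_neq0 : lam != 0.
    by have /irrP[k ->] := lin_char_irr linlam; apply: irr_neq0.
  rewrite cfker_Ind ?lin_charW //.
  by rewrite sub_gcore ?lin_char_der1 // gFnorm_trans ?normal_norm.
by rewrite cfInd1 // lin_char1 // mulr1.
Qed.

Lemma normally_monomial_irr1_le i j :
    normally_monomial_char 'chi[G]_i -> cfker 'chi_i \subset cfker 'chi[G]_j ->
  'chi_j 1%g <= 'chi_i 1%g.
Proof.
move=> /normally_monomial_charP[N [nsNG sN'K ->]] sKK.
by apply: irr1_le_index (normal_sub nsNG) (subset_trans sN'K sKK).
Qed.

(** A normal subgroup is the intersection of the kernels of irreducible characters that contain
    it. *)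
Lemma irr_cfker_separate (L : {group gT}) (A : {set gT}) :
    L <| G -> ~~ (A \subset L) ->
  exists i, L \subset cfker 'chi[G]_i /\ ~~ (A \subset cfker 'chi_i).
Proof.
move=> nsLG; rewrite -{1}(cap_cfker_normal nsLG).
have [i /andP[sLK nsAK] _ | none] := pickP [pred i |
  (L \subset cfker 'chi[G]_i) && ~~ (A \subset cfker 'chi_i)].
  by exists i.
case/negP; apply/bigcapsP=> i sLK.
by have := none i; rewrite /= sLK => /negbFE.
Qed.

(** The degree divides the index of the centre of ['chi_i], hence the index of its kernel, which is
    a power of [p]. *)
Lemma irr_codegreeP p i : prime p -> p.-group G -> exists e d,
  [/\ 'chi[G]_i 1%g = (p ^ d)%:R, #|G : cfker 'chi_i| = (p ^ (e + d))%N
    & codegree 'chi_i = (p ^ e)%:R].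
Proof.
move=> p_pr pG; have /natrP[m chi1] := Cnat_irr1 i.
have := dvd_irr1_index_center i; rewrite chi1 dvdC_nat => m_dvd.
have [sKZ _] := andP (cfker_center_normal 'chi_i).
have {}m_dvd : (m %| #|G : cfker 'chi_i|)%N.
  by rewrite -(Lagrange_index (cfcenter_sub 'chi_i) sKZ) dvdn_mulr.
have [k oGK] := p_natP (pnat_dvd (dvdn_indexg G (cfker_group 'chi_i)) pG).
move: m_dvd; rewrite oGK => /(dvdn_pfactor _ _ p_pr)[d le_dk Dm].
exists (k - d)%N, d; rewrite Dm subnK //; split=> //.
rewrite /codegree chi1 Dm oGK; apply: (canLR (mulfK _)).
  by rewrite pnatr_eq0 expn_eq0 negb_and -lt0n prime_gt0.
by rewrite -natrM -expnD subnK.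
Qed.

Lemma exists_codegree_prime p : prime p -> p.-group G -> G :!=: 1%g ->
  exists i, codegree 'chi[G]_i = p%:R.
Proof.
move=> p_pr pG ntG.
case: (maximal_exists (sub1G G)) => [G1 | [M maxM _]].
  by rewrite -G1 eqxx in ntG.
have nsMG := p_maximal_normal pG maxM.
have oGM := p_maximal_index pG maxM.
have [ltMG maxP] := maxgroupP maxM.
have [i [sMK nsGK]] := irr_cfker_separate nsMG (proper_subn ltMG).
(* The kernel is proper and contains the maximal subgroup [M], of index [p]. *)
exists i; have eqKM : cfker 'chi_i = M.
  apply: (maxP (cfker_group 'chi_i)) sMK.
  by rewrite properE cfker_sub.
have lini : 'chi_i \is a linear_char.
  rewrite lin_irr_der1 eqKM der1_min ?normal_norm //.
  rewrite cyclic_abelian // prime_cyclic //.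
  by rewrite card_quotient ?normal_norm // oGM.
by rewrite /codegree lin_char1 // divr1 eqKM oGM.
Qed.

Lemma codegreesP x :
  reflect (exists i, codegree 'chi[G]_i = x) (x \in codegrees G).
Proof.
apply: (iffP mapP) => [[_ /irrP[i ->] ->] | [i <-]]; first by exists i.
by exists 'chi_i; rewrite ?mem_irr.
Qed.

Lemma irr1_le_max_irr_degree i d :
  'chi[G]_i 1%g = d%:R -> (d <= max_irr_degree G)%N.
Proof.
move=> chi1; rewrite -[leqLHS](@natrK algC) -chi1.
by rewrite /max_irr_degree (big_rem _ (mem_irr i)) leq_maxl.
Qed.

End Codegrees.

(** * Normal subgroups and character kernels in maximal class *)

Section MaximalClass.

Variables (p n : nat) (gT : finGroupType) (G : {group gT}).
Hypotheses (p_prime : prime p) (n_ge3 : (3 <= n)%N).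
Hypotheses (oG : #|G| = (p ^ n)%N) (clG : nil_class G = n.-1).

Let pG : p.-group G. Proof. by rewrite /pgroup oG pnatX pnat_id. Qed.

Let nilG : nilpotent G. Proof. exact: pgroup_nil pG. Qed.

Lemma ucn_maxclass_proper i : (i < n.-1)%N -> 'Z_i(G) != G.
Proof.
by rewrite -clG ltnNge; apply: contraNneq => /(ucn_nil_classP _ nilG).
Qed.

(** A stationary step would give [G / 'Z_i(G)] trivial centre, so nilpotency would force
    ['Z_i(G) = G]. *)
Lemma logn_ucn_ltn i :
  (i < n.-1)%N -> (logn p #|'Z_i(G)| < logn p #|'Z_i.+1(G)|)%N.
Proof.
move=> lt_i; have nsZG := ucn_normal i G.
rewrite -(ltn_exp2l _ _ (prime_gt1 p_prime)) -!card_pgroup //; last 2 first.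
- exact: pgroupS (ucn_sub _ _) pG.
- exact: pgroupS (ucn_sub _ _) pG.
apply: proper_card; rewrite properEneq ucn_subS andbT.
apply: contraNneq (ucn_maxclass_proper lt_i) => eqZ.
have: 'Z(G / 'Z_i(G))%g == 1%g by rewrite -ucn_central -eqZ trivg_quotient.
rewrite center_nil_eq1 ?quotient_nil // -subG1.
rewrite quotient_sub1 ?ucn_norm // => sGZ.
by rewrite eqEsubset ucn_sub.
Qed.

Lemma logn_ucn_leq i j : (i <= j < n)%N ->
  (logn p #|'Z_i(G)| + (j - i) <= logn p #|'Z_j(G)|)%N.
Proof.
case/andP; elim: j => [|j IHj].
  by rewrite leqn0 => /eqP-> _; rewrite addn0.
rewrite leq_eqVlt => /predU1P[-> _|]; first by rewrite subnn addn0.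
rewrite ltnS => le_ij lt_jn; rewrite subSn // addnS.
apply: leq_ltn_trans (IHj le_ij (ltnW lt_jn)) (logn_ucn_ltn _).
by rewrite -ltnS prednK // (leq_trans _ n_ge3).
Qed.

(** Strict growth from ['Z_0(G)] bounds the order below; strict growth up to ['Z_(n - 2)(G)], of
    order at most p^(n - 2), bounds it above. *)
Lemma card_ucn_maxclass i : (i <= n - 2)%N -> #|'Z_i(G)| = (p ^ i)%N.
Proof.
move=> le_i; rewrite (card_pgroup (pgroupS (ucn_sub i G) pG)); congr (_ ^ _)%N.
have lo : (i <= logn p #|'Z_i(G)|)%N.
  have /logn_ucn_leq : (0 <= i < n)%N by lia.
  by rewrite ucn0 cards1 logn1 subn0.
have up : (logn p #|'Z_i(G)| + (n - 2 - i) <= logn p #|'Z_(n - 2)(G)|)%N.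
  by apply: logn_ucn_leq; lia.
suffices top: (logn p #|'Z_(n - 2)(G)| <= n - 2)%N.
  apply/eqP; rewrite eqn_leq lo andbT -(leq_add2r (n - 2 - i)).
  by rewrite (leq_trans up) // subnKC.
(* Otherwise [G / 'Z_(n - 3)(G)] would be cyclic modulo its centre. *)
rewrite leqNgt; apply/negP => gt_top.
have cycQ : cyclic (G / 'Z_(n - 2)(G)).
  apply: (dvdn_prime_cyclic p_prime).
  rewrite card_quotient ?ucn_norm // -(dvdn_pmul2l (cardG_gt0 'Z_(n - 2)(G))).
  rewrite Lagrange ?ucn_sub // oG (card_pgroup (pgroupS (ucn_sub _ G) pG)).
  by rewrite -expnSr dvdn_exp2l //; move: gt_top; move: (logn _ _) => z; lia.
have n2 : (n - 2 = (n - 3).+1)%N by lia.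
have lt_n3 : (n - 2 < n.-1)%N by lia.
have := ucn_maxclass_proper lt_n3; case/negP.
rewrite n2 in cycQ *.
have abQ : abelian (G / 'Z_(n - 3)(G)).
  apply: cyclic_center_factor_abelian.
  rewrite -ucn_central.
  by rewrite (isog_cyclic (third_isog _ _ _)) ?ucn_normal // ucn_subS.
have: ('Z_(n - 3).+1(G) / 'Z_(n - 3)(G))%g = (G / 'Z_(n - 3)(G))%g.
  by rewrite ucn_central; apply/center_idP.
move/(quotient_inj (ucn_normalS _ _) (ucn_normal _ _)) => -> //.
Qed.

(** If [N] strictly contains ['Z_i(G)], its image in [G / 'Z_i(G)] meets the centre of that
    nilpotent group; this centre is ['Z_i.+1(G) / 'Z_i(G)], of order [p], so it lies in the
    image. *)
Lemma normal_maxclassP i (N : {group gT}) : (i <= n - 2)%N -> N <| G ->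
  'Z_i(G) \subset N \/ exists2 j, (j < i)%N & N :=: 'Z_j(G).
Proof.
move=> le_i nsNG; elim: i le_i => [|i IHi] le_i; first by left; apply: sub1G.
case: (IHi (ltnW le_i)) => [sZN | [j lt_ji ->]]; last first.
  by right; exists j; rewrite // ltnS ltnW.
have nsZG := ucn_normal i G.
have nsZN : 'Z_i(G) <| N := normalS sZN (normal_sub nsNG) nsZG.
have [/eqP | ntQ] := eqVneq (N / 'Z_i(G))%g 1%g.
  rewrite -subG1 quotient_sub1 ?normal_norm // => sNZ.
  by right; exists i => //; apply/eqP; rewrite eqEsubset sNZ.
left; have nilQ := quotient_nil 'Z_i(G) nilG.
have := meet_center_nil nilQ (quotient_normal _ nsNG) ntQ.
rewrite setIC -ucn_central /= => ntI.
have oQ : #|('Z_i.+1(G) / 'Z_i(G))%g| = p.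
  rewrite card_quotient ?normal_norm ?ucn_normalS // -divgS ?ucn_subS //.
  rewrite !card_ucn_maxclass ?(ltnW le_i) // expnS.
  by rewrite mulnK ?expn_gt0 ?prime_gt0.
have : ('Z_i.+1(G) / 'Z_i(G))%g \subset (N / 'Z_i(G))%g.
  by apply: contraR ntI => /prime_TIg->; rewrite ?oQ.
by rewrite quotientSGK // ?normal_norm ?ucn_normalS.
Qed.

Lemma irr_next_kernel e i :
    codegree 'chi[G]_i = (p ^ e)%:R -> (3 <= e)%N ->
  exists j, cfker 'chi[G]_i \subset cfker 'chi[G]_j
         /\ #|G : cfker 'chi_i| = (p * #|G : cfker 'chi_j|)%N.
Proof.
have [e1 [d [chi1 oGK ->]]] := irr_codegreeP i p_prime pG.
move/eqP; rewrite eqr_nat eqn_exp2l ?prime_gt1 // => /eqP De1 e_ge3.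
subst e1.
have indexZ k : (k <= n - 2)%N -> #|G : 'Z_k(G)| = (p ^ (n - k))%N.
  move=> le_k; rewrite -divgS ?ucn_sub // oG card_ucn_maxclass //.
  by rewrite -expnB ?prime_gt0 //; lia.
have nsK k : cfker_group 'chi[G]_k <| G := cfker_normal _.
(* A kernel containing ['Z_(n - 2)(G)] has index at most p^2, against [3 <= e]. *)
have [sZK | [k lt_k DK]] := normal_maxclassP (leqnn _) (nsK i).
  have := indexgS G sZK; rewrite oGK indexZ // dvdn_Pexp2l ?prime_gt1 //.
  by lia.
rewrite /= in DK; have := oGK; rewrite DK indexZ ?(ltnW lt_k) // => /eqP.
rewrite eqn_exp2l ?prime_gt1 // => /eqP n_k.
have {lt_k} [Dk | lt_k] : (k = n - 3 \/ k < n - 3)%N by lia.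
  (* Index p^3 and codegree at least p^3 would make chi linear, but
     G / 'Z_(n - 3)(G) is not abelian. *)
  have d0 : d = 0%N by lia.
  have : 'chi_i \is a linear_char.
    by rewrite qualifE /= irr_char chi1 d0 expn0 eqxx.
  rewrite lin_irr_der1 DK => sG'Z.
  have /negP[] := @ucn_maxclass_proper k.+1 ltac:(lia).
  rewrite eqEsubset ucn_sub ucnSnR; apply/subsetP=> x Gx.
  by rewrite inE Gx (subset_trans _ sG'Z) // commSg ?sub1set.
have nsL := ucn_normal k.+1 G.
have nsub : ~~ ('Z_k.+2(G) \subset 'Z_k.+1(G)).
  apply/negP=> /subset_leq_card; rewrite !card_ucn_maxclass; try lia.
  by rewrite leq_exp2l ?prime_gt1 // ltnn.
(* A kernel that contains ['Z_k.+1(G)] but not ['Z_k.+2(G)] must be ['Z_k.+1(G)]. *)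
have [j [sLK nsZK]] := irr_cfker_separate nsL nsub.
have le_k2 : (k.+2 <= n - 2)%N by lia.
case: (normal_maxclassP le_k2 (nsK j)) => /= [sZK | [m lt_m DKj]].
  by rewrite sZK in nsZK.
have Dm : m = k.+1.
  have := subset_leq_card sLK; rewrite DKj !card_ucn_maxclass; try lia.
  by rewrite leq_exp2l ?prime_gt1 //; lia.
exists j; rewrite DKj Dm ucn_subS !indexZ; try lia.
by split=> //; rewrite -expnS; congr (_ ^ _)%N; lia.
Qed.

(** * Descent on codegrees, and a faithful character *)

Hypothesis nmG : normally_monomial G.

Lemma codegrees_downward_closed i e :
    codegree 'chi[G]_i = (p ^ e)%:R -> forall k, (k <= e)%N ->
  exists j, codegree 'chi[G]_j = (p ^ k)%:R.
Proof.
(* Induct on the kernel index rather than on [e]: the next exponent is only known to be at least e -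
   1. *)
have [m] := ubnP #|G : cfker 'chi_i|; elim: m => // m IHm in i e *.
rewrite ltnS => le_m cod_i k; rewrite leq_eqVlt => /predU1P[->|lt_ke].
  by exists i.
(* Exponents 0 and 1 come from the principal character and a maximal subgroup; a target of at least
   2 below [e] forces [3 <= e]. *)
case: k lt_ke => [|[|k]] lt_ke.
- exists 0; rewrite /codegree irr0 cfker_cfun1 indexgg cfun11 divr1.
  by rewrite expn0.
- rewrite expn1; apply: exists_codegree_prime p_prime pG _.
  rewrite -cardG_gt1 oG -(expn0 p) ltn_exp2l ?prime_gt1 //; lia.
have [j [sKK oGK]] := irr_next_kernel cod_i ltac:(lia).
have [f [d [chij oGKj cod_j]]] := irr_codegreeP j p_prime pG.
have lt_j : (#|G : cfker 'chi_j| < m)%N.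
  by rewrite (leq_trans _ le_m) // oGK ltn_Pmull ?prime_gt1.
apply: IHm lt_j cod_j _ _.
have [e1 [d1 [chii oGKi]]] := irr_codegreeP i p_prime pG.
rewrite cod_i => /eqP; rewrite eqr_nat eqn_exp2l ?prime_gt1 // => /eqP De1.
subst e1.
(* The degree cannot grow, so d <= d1; with e + d1 = f + d + 1 this gives f >= e - 1. *)
have := normally_monomial_irr1_le (nmG (mem_irr i)) sKK.
rewrite chii chij ler_nat leq_exp2l ?prime_gt1 // => le_d.
move/eqP: oGK; rewrite oGKi oGKj -expnS eqn_exp2l ?prime_gt1 // => /eqP; lia.
Qed.

(** Every nontrivial normal subgroup contains ['Z_1(G)], so it suffices that the kernel does not. *)
Lemma exists_faithful_irr : exists i, cfker 'chi[G]_i = 1%g.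
Proof.
have [|i [_ nsZK]] := irr_cfker_separate (normal1 G) (A := 'Z_1(G)).
  apply/negP=> /subset_leq_card; rewrite card_ucn_maxclass ?cards1; last lia.
  by rewrite -(expn0 p) leq_exp2l ?prime_gt1.
exists i; have n2_gt0 : (1 <= n - 2)%N by lia.
case: (normal_maxclassP n2_gt0 (cfker_normal 'chi_i)) => [sZK | [[|//] _ ->]] //.
by rewrite sZK in nsZK.
Qed.

End MaximalClass.

(** Degrees are powers of [p], so [trunc_log] is the exact logarithm of b(G). The witness [c] is the
    largest exponent that occurs. *)
Theorem theoremD (p n : nat) (gT : finGroupType) (G : {group gT})
    (p_prime : prime p)
    (G_maxclass : maximal_class p G)
    (G_nm : normally_monomial G)
    (G_order : #|G| = (p ^ n)%N) :
  let b := trunc_log p (max_irr_degree G) in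
  exists c : nat,
    (n - b <= c)%N /\
    codegrees G =i [seq (p ^ i)%:R : algC | i <- iota 0 c.+1].
Proof.
move=> b; case: G_maxclass => n1 [n1_ge3 oG1 clG].
have Dn1 : n1 = n.
  by apply/eqP; rewrite -(eqn_exp2l _ _ (prime_gt1 p_prime)) -oG1 G_order.
subst n1; have pG : p.-group G by rewrite /pgroup G_order pnatX pnat_id.
pose Q k := (p ^ k)%:R \in codegrees G.
have cod_exp i e : codegree 'chi[G]_i = (p ^ e)%:R -> Q e.
  by move=> cod_i; apply/codegreesP; exists i.
have down k e : Q e -> (k <= e)%N -> Q k.
  case/codegreesP=> i cod_i le_ke; apply/codegreesP.
  have downG := codegrees_downward_closed p_prime n1_ge3 G_order clG G_nm.
  exact: downG cod_i k le_ke.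
have exQ : exists k, Q k.
  by have [e [d [_ _ /cod_exp]]] := irr_codegreeP 0 p_prime pG; exists e.
have ubQ k : Q k -> (k <= n)%N.
  case/codegreesP=> i cod_i; have [e [d [_ oGK]]] := irr_codegreeP i p_prime pG.
  rewrite cod_i => /eqP; rewrite eqr_nat eqn_exp2l ?prime_gt1 // => /eqP->.
  have := dvdn_leq (cardG_gt0 G) (dvdn_indexg G (cfker_group 'chi_i)).
  by rewrite /= oGK G_order leq_exp2l ?prime_gt1 //; apply/leq_trans/leq_addr.
have [c Qc maxc] := ex_maxnP exQ ubQ; exists c; split.
  (* A faithful character of degree p^d has codegree p^(n - d), and d <= b. *)
  have [i fful_i] := exists_faithful_irr p_prime n1_ge3 G_order clG.
  have [e [d [chi1 oGK /cod_exp/maxc le_ec]]] := irr_codegreeP i p_prime pG.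
  move/eqP: oGK; rewrite fful_i indexg1 G_order eqn_exp2l ?prime_gt1 //.
  move/eqP=> n_ed; rewrite (leq_trans _ le_ec) // leq_subLR.
  rewrite n_ed addnC leq_add2r.
  by rewrite trunc_log_max ?prime_gt1 ?(irr1_le_max_irr_degree chi1).
move=> x; apply/codegreesP/mapP => [[i <-] | [k]].
  have [e [d [_ _ cod_i]]] := irr_codegreeP i p_prime pG.
  by exists e; rewrite // mem_iota ltnS maxc ?(cod_exp i).
by rewrite mem_iota ltnS => /(down _ _ Qc)/codegreesP[i cod_i] ->; exists i.
Qed.
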